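(* Let $(X,\|\cdot\|)$ be an infinite-dimensional Fréchet space and let $\mathcal{V}=\{V_n\}_{n\in\mathbb{N}}$ be a nested sequence of linear subspaces of $X$ such that $\overline{V_n}\subseteq V_{n+1}$ for every $n\in\mathbb{N}$ and $X=\overline{\bigcup_{n=1}^{\infty}V_n}$. Let $\{e_n\}_{n\in\mathbb{N}}$ be a decreasing sequence of positive numbers tending to $0$. Assume that $d_{\mathcal{V}}=\inf\{d_{n,\mathcal{V}}: n\in\mathbb{N}\}>0$. Then there exists $x\in X$ such that $\rho_n(x)\neq O(e_n)$, i.e. there is no $M>0$ such that $\rho_n(x)\leq M e_n$ for all $n$.
   Context: $\mathbb{N}=\{1,2,\dots\}$. A Fréchet space $(X,\|\cdot\|)$ is a (real or complex) metric linear space which is complete with respect to an F-norm $\|\cdot\|$ giving its topology; an F-norm satisfies $\|x\|=0$ iff $x=0$, $\|\alpha x\|=\|x\|$ for all scalars with $|\alpha|=1$, and $\|x+y\|\leq\|x\|+\|y\|$ (no local convexity is assumed; scalar multiplication is continuous). Closures are taken with respect to $\|\cdot\|$. For $x\in X$, $\rho_n(x)=\mathrm{dist}(x,V_n)=\inf\{\|x-v\|:v\in V_n\}$, and $d_{n,\mathcal{V}}=\sup\{\rho_n(v):v\in V_{n+1}\}\in[0,\infty]$. *)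

(* Defs.v *)
From HB Require Import structures.
From mathcomp Require Import all_boot all_order all_algebra.
From mathcomp Require Import all_classical all_reals all_analysis.
From mathcomp.real_closed Require Import complex.

Set Implicit Arguments.
Unset Strict Implicit.
Unset Printing Implicit Defensive.

Import Order.TTheory GRing.Theory Num.Theory.
Import numFieldNormedType.Exports.

Local Open Scope classical_set_scope.
Local Open Scope ring_scope.

Inductive real_or_complex (R : realType) : numFieldType -> Prop :=
| RealScalars : real_or_complex R (R : numFieldType)
| ComplexScalars : real_or_complex R (R[i] : numFieldType).

Section Frechet.
Variables (R : realType) (K : numFieldType).

(* Nonnegativity of [N] follows from the three axioms:
   [0 = N (x - x) <= N x + N (- x) = N x + N x]. *)
Record F_norm (X : lmodType K) (N : X -> R) : Prop := {
  F_norm_eq0 : forall x, N x = 0 <-> x = 0 ;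
  F_norm_unit : forall (a : K) x, `|a| = 1 -> N (a *: x) = N x ;
  F_norm_triangle : forall x y, N (x + y) <= N x + N y }.

(* The continuity of addition and scalar multiplication belongs to
   [topologicalLmodType]; unlike [tvsType], it does not assume local
   convexity. *)
Record frechet (X : topologicalLmodType K) (N : X -> R) : Prop := {
  frechet_F_norm : F_norm N ;
  frechet_nbhs : forall (x : X) (A : set X),
    nbhs x A <->
    exists2 eps : R, 0 < eps & [set y | N (y - x) < eps] `<=` A ;
  frechet_complete : forall u : nat -> X,
    (forall eps : R, 0 < eps ->
       exists n0 : nat, forall m n : nat, (n0 <= m)%N -> (n0 <= n)%N ->
         N (u m - u n) < eps) ->
    exists l : X, u @ \oo --> l }.

Definition finite_dimensional (X : lmodType K) : Prop :=
  exists (n : nat) (b : 'I_n -> X),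
    forall x : X, exists c : 'I_n -> K, x = \sum_(i < n) c i *: b i.

Definition linear_subspace (X : lmodType K) (V : set X) : Prop :=
  submod_closed [in V].

Definition fdist (X : lmodType K) (N : X -> R) (x : X) (V : set X) : R :=
  inf [set N (x - v) | v in V].

Section Approximation.
(* The sequences are indexed from 0: [V n] is the space written V_{n+1} when
   indices start at 1, and likewise for [rho], [d_] and the errors e_n. *)
Variables (X : lmodType K) (N : X -> R) (V : nat -> set X).

Definition rho (n : nat) (x : X) : R := fdist N x (V n).

Definition d_ (n : nat) : \bar R :=
  ereal_sup [set (rho n v)%:E | v in V n.+1].

Definition d_inf : \bar R := ereal_inf (range d_).

End Approximation.
End Frechet.

(* Main.v *)
Require Import Defs.
From HB Require Import structures.
From mathcomp Require Import all_boot all_order all_algebra.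
From mathcomp Require Import all_classical all_reals all_analysis.
From mathcomp Require Import complex ring lra.

Set Implicit Arguments.
Unset Strict Implicit.
Unset Printing Implicit Defensive.

Import Order.TTheory GRing.Theory Num.Theory.
Import numFieldNormedType.Exports.

Local Open Scope classical_set_scope.
Local Open Scope ring_scope.

(** The argument is a Baire category (gliding hump) argument, which uses that
    each [V n] is a linear subspace and that the [d_ N V n] are bounded below
    by a common [c > 0].

    Every ball around the origin contains, for every [n], a vector whose
    distance to [V n] is at least some [delta > 0] independent of [n]
    ([small_far_vector]).  An F-norm is not homogeneous, so such a vector
    cannot be obtained by normalizing one far from [V n]; instead, one starts
    from [v] with [rho n v > c] and halves it until its distance to [V n] first
    drops below the minimum of [c] and the radius.  Subadditivity prevents a
    single halving from dividing the distance by more than two, so the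
    distance is still bounded below, and a translation by an element of [V n]
    makes the norm of the vector as close to this distance as desired.

    Now fix a ball and a constant [M], and choose [n] with [M * e n] small
    compared with the corresponding [delta].  If the centre [x] does not
    already satisfy [rho n x > M * e n], then adding such a vector to it
    yields a point that does ([exists_near_rho_gt]).  Hence the sets
    [{x | exists n, rho n x > k * e n}] are dense, and they are open because
    [rho n] is 1-Lipschitz.  By completeness they have a common point
    ([bigcap_interior_dense]), whose [rho n] is not O(e n). *)

(** * F-norms and the distance to a subspace *)

Section FNorm.
Variables (R : realType) (K : numFieldType) (X : lmodType K) (N : X -> R).
Hypothesis HN : F_norm N.

Lemma F_norm0 : N 0 = 0.
Proof. by apply/(F_norm_eq0 HN). Qed.

Lemma F_normN x : N (- x) = N x.
Proof. by rewrite -scaleN1r (F_norm_unit HN) ?normrN1. Qed.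

Lemma F_normB x y : N (x - y) = N (y - x).
Proof. by rewrite -opprB F_normN. Qed.

Lemma F_norm_ge0 x : 0 <= N x.
Proof.
have := F_norm_triangle HN x (- x).
rewrite subrr F_norm0 F_normN; lra.
Qed.

Lemma F_norm_triangleB x y z : N (x - z) <= N (x - y) + N (y - z).
Proof.
have := F_norm_triangle HN (x - y) (y - z).
by rewrite addrA subrK.
Qed.

Variable W : set X.
Hypothesis Wlin : linear_subspace W.

Lemma subspace0 : W 0.
Proof. by have := Wlin.1; rewrite inE. Qed.

Lemma subspaceZD a u v : W u -> W v -> W (a *: u + v).
Proof.
move=> Wu Wv; have := Wlin.2 a u v.
by rewrite !inE; apply.
Qed.

Lemma fdist_lbound x : has_lbound [set N (x - v) | v in W].
Proof. by exists 0 => _ [v _ <-]; exact: F_norm_ge0. Qed.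

Lemma fdist_nonempty x : [set N (x - v) | v in W] !=set0.
Proof. by exists (N (x - 0)), 0; first exact: subspace0. Qed.

Lemma fdist_le x v : W v -> fdist N x W <= N (x - v).
Proof. by move=> Wv; apply: ge_inf; [exact: fdist_lbound | exists v]. Qed.

Lemma fdist_le_norm x : fdist N x W <= N x.
Proof. by rewrite -{2}[x]subr0; apply/fdist_le/subspace0. Qed.

Lemma fdist_approx x eps : 0 < eps ->
  exists2 v, W v & N (x - v) < fdist N x W + eps.
Proof.
move=> eps0.
have [_ [v Wv <-] ltv] :=
  inf_adherent eps0 (conj (fdist_nonempty x) (fdist_lbound x)).
by exists v.
Qed.

Lemma fdist_subspace v : W v -> fdist N v W <= 0.
Proof. by move/(fdist_le v); rewrite subrr F_norm0. Qed.

(** Subadditivity together with invariance under unimodular scalars; [fdistD]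
    and [fdistB] are the instances [a = 1] and [a = -1]. *)
Lemma fdistDZ a x y : `|a| = 1 ->
  fdist N (a *: x + y) W <= fdist N x W + fdist N y W.
Proof.
move=> a1; apply/ler_addgt0Pr => eps eps0.
have eps20 : 0 < eps / 2 by lra.
have [u Wu ltu] := fdist_approx x eps20.
have [v Wv ltv] := fdist_approx y eps20.
have := fdist_le (a *: x + y) (subspaceZD a Wu Wv).
have -> : a *: x + y - (a *: u + v) = a *: (x - u) + (y - v).
  by rewrite scalerBr opprD addrACA.
have := F_norm_triangle HN (a *: (x - u)) (y - v).
rewrite (F_norm_unit HN) //; lra.
Qed.

Lemma fdistD x y : fdist N (x + y) W <= fdist N x W + fdist N y W.
Proof. by rewrite -{1}[x]scale1r fdistDZ ?normr1. Qed.

Lemma fdistB x y : fdist N (x - y) W <= fdist N x W + fdist N y W.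
Proof. by rewrite addrC [leRHS]addrC -scaleN1r fdistDZ ?normrN1. Qed.

Lemma fdist_lipschitz x y : fdist N x W <= fdist N y W + N (x - y).
Proof.
have := fdistD y (x - y); rewrite addrC subrK.
by have := fdist_le_norm (x - y); lra.
Qed.

(** The substitute for the homogeneity that an F-norm lacks. *)
Lemma fdist_half x : fdist N x W <= fdist N (2^-1 *: x) W *+ 2.
Proof.
have {1}-> : x = 2^-1 *: x + 2^-1 *: x.
  by rewrite -scalerDl -mulr2n -[_ *+ 2]mulr_natr mulVf ?scale1r ?pnatr_eq0.
by rewrite mulr2n fdistD.
Qed.

End FNorm.

(** * Small vectors far from a subspace *)

(** The archimedean property of the scalars: the topology of [K] is given by
    balls whose radii lie in [K], and in the complex case a positive radius
    has zero imaginary part. *)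
Lemma exists_half_expn_lt (R : realType) (K : numFieldType) (eps : K) :
  real_or_complex R K -> 0 < eps -> exists k, 2^-1 ^+ k < eps.
Proof.
have archi (d : R) : 0 < d -> exists k, 2^-1 ^+ k < d.
  move=> d0; have [k _ /(_ k (leqnn k))] := near_infty_natSinv_expn_lt (PosNum d0).
  by rewrite /= div1r -exprVn; exists k.
move=> HK; case: HK eps => [|[a b]]; first exact: archi.
rewrite ltcE /= => /andP[/eqP -> a0].
have [k ltk] := archi _ a0; exists k.
have -> : (2^-1 ^+ k : R[i]) = ((2^-1 ^+ k)%:C)%C.
  by rewrite rmorphXn /= fmorphV rmorph_nat.
by rewrite ltcR.
Qed.

Section Frechet.
Variables (R : realType) (K : numFieldType) (HK : real_or_complex R K).
Variables (X : topologicalLmodType K) (N : X -> R) (HX : frechet N).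

Let HN : F_norm N := frechet_F_norm HX.

Lemma exists_half_expn_scale (x : X) eps : 0 < eps ->
  exists k, N (2^-1 ^+ k *: x) < eps.
Proof.
move=> eps0.
have : nbhs (0 *: x : X) [set y | N y < eps].
  apply/(frechet_nbhs HX); exists eps => // y /=.
  by rewrite scale0r subr0.
move=> /(@scale_continuous K X ((0 : K^o), x)) [[A B] /= [A0 Bx] sAB].
have [d d0 sdA] := (nbhs_ballP (0 : K^o) A).1 A0.
have [k ltk] := exists_half_expn_lt HK d0.
exists k; apply: (sAB (2^-1 ^+ k, x)); split => /=; last exact: nbhs_singleton.
apply: sdA; rewrite /ball /= sub0r normrN ger0_norm //.
Qed.

(** The witness is [2^-(k+1) v - u], where [k+1] is the first exponent at
    which the distance of the halved vector to [W] is below [c], so that by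
    [fdist_half] it is at least [c / 2], and where [u] is a nearly best
    approximation in [W]: this brings the norm below [r] without changing the
    distance to [W].  The bound [c / 2] depends neither on [v] nor on [W]. *)
Lemma small_far_vector (W : set X) (Wlin : linear_subspace W) (v : X) (c r : R) :
    0 < r -> 0 < c -> c <= r -> c <= fdist N v W ->
  exists2 w, N w < r & c / 2 <= fdist N w W.
Proof.
move=> r0 c0 cr cv.
have exk : exists k, fdist N (2^-1 ^+ k *: v) W < c.
  have [k ltk] := exists_half_expn_scale v c0.
  by exists k; apply: le_lt_trans ltk; exact: fdist_le_norm.
case: (ex_minnP exk) => -[|k]; first by rewrite expr0 scale1r ltNge cv.
set x := (X in fdist N X W < c) => ltx mink.
have lex : c / 2 <= fdist N x W.
  have : c <= fdist N (2^-1 ^+ k *: v) W.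
    by rewrite leNgt; apply/negP => /mink; rewrite ltnn.
  have := fdist_half HN Wlin (2^-1 ^+ k *: v).
  rewrite scalerA -exprS -/x; lra.
have [u Wu ltu] : exists2 u, W u & N (x - u) < fdist N x W + (r - fdist N x W).
  by apply: fdist_approx => //; lra.
exists (x - u); first by lra.
have := fdistD HN Wlin (x - u) u; rewrite subrK.
by have := fdist_subspace HN Wu; lra.
Qed.

(** * Density of the sets of badly approximated vectors *)

Variables (V : nat -> set X) (e : nat -> R).
Hypothesis Vlin : forall n, linear_subspace (V n).
Hypothesis e_lim : e @ \oo --> (0 : R).

Lemma d_inf_gt0_witness : (0 < d_inf N V)%E ->
  exists2 c : R, 0 < c & forall n, exists v, c < rho N V n v.
Proof.
move=> d_pos.
have [c c0 ltc] : exists2 c : R, 0 < c & (c%:E < d_inf N V)%E.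
  case: (d_inf N V) d_pos => [d| |] //.
    by rewrite lte_fin => d0; exists (d / 2); rewrite ?lte_fin; lra.
  by exists 1; rewrite ?ltry.
exists c => // n.
have /ereal_sup_gt[_ [v _ <-]] : (c%:E < d_ N V n)%E.
  by apply: lt_le_trans ltc _; apply: ereal_inf_lbound; exists n.
by rewrite lte_fin; exists v.
Qed.

(** Either the centre [x] itself will do, or it is so close to [V n] that
    adding a small vector far from [V n] brings it away from [V n]. *)
Lemma exists_near_rho_gt (c : R) : 0 < c ->
    (forall n, exists v, c < rho N V n v) ->
  forall (x : X) (r M : R), 0 < r ->
    exists2 y, N (y - x) < r & exists n, M * e n < rho N V n y.
Proof.
move=> c0 cV x r M r0.
(* The hump has norm below [r] and lies at distance at least [d / 2] from
   [V n], where [d] is independent of [n]; at most [d / 4] of this distance is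
   lost when [x] is added, and [d / 4] still exceeds [M * e n]. *)
pose d := Num.min c r.
have d0 : 0 < d by rewrite lt_min c0.
have [n ltn] : exists n, M * e n < d / 4.
  have : (fun n => M * e n) @ \oo --> (0 : R).
    by rewrite -(mulr0 M); exact: cvgMl_tmp.
  move=> /cvgr_lt/(_ (d / 4)) [|n _ /(_ n (leqnn n)) lt_n]; first by lra.
  by exists n.
have [ltx|lex] := ltP (M * e n) (rho N V n x).
  by exists x; [rewrite subrr (F_norm0 HN) | exists n].
have [v ltv] := cV n.
have [w ltw lew] : exists2 w, N w < r & d / 2 <= fdist N w (V n).
  apply: (small_far_vector (Vlin n) (v := v)) => //.
    by rewrite /d ge_min lexx orbT.
  by apply: ltW; apply: le_lt_trans ltv; rewrite /d ge_min lexx.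
exists (x + w); first by rewrite addrAC subrr add0r.
exists n; have := fdistB HN (Vlin n) (x + w) x; rewrite addrAC subrr add0r.
move: lex; rewrite /rho; lra.
Qed.

(** * The Baire category argument *)

(** The third hypothesis says, through the triangle inequality, that the closed
    balls of centre [u k] and radius [r k] are nested. *)
Lemma nested_balls_limit (u : nat -> X) (r : nat -> R) :
    (forall k, 0 < r k) -> r @ \oo --> (0 : R) ->
    (forall k, N (u k.+1 - u k) + r k.+1 <= r k) ->
  exists l, forall k, N (l - u k) <= r k.
Proof.
move=> r0 r_lim ur.
have nested k j : N (u (k + j)%N - u k) + r (k + j)%N <= r k.
  elim: j => [|j IH]; first by rewrite addn0 subrr (F_norm0 HN) add0r.
  have := F_norm_triangleB HN (u (k + j.+1)%N) (u (k + j)%N) (u k).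
  by have := ur (k + j)%N; rewrite addnS; lra.
have close k m : (k <= m)%N -> N (u m - u k) < r k.
  move=> /subnKC <-; have := nested k (m - k)%N.
  by have := r0 (k + (m - k))%N; lra.
have [|l ul] := frechet_complete HX (u := u).
  move=> eps eps0.
  have eps20 : 0 < eps / 2 by lra.
  have [n _ /(_ n (leqnn n)) rn] := cvgr_lt _ r_lim _ eps20.
  exists n => i j /close ni /close nj.
  have := F_norm_triangleB HN (u i) (u n) (u j).
  by rewrite (F_normB HN (u n) (u j)); move: rn => /=; lra.
exists l => k; apply/ler_addgt0Pr => eps eps0.
have /ul[m _ um] : nbhs l [set y | N (y - l) < eps].
  by apply/(frechet_nbhs HX); exists eps.
have := um (maxn k m) (leq_maxr k m); rewrite /= (F_normB HN).
have := close k (maxn k m) (leq_maxl k m).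
have := F_norm_triangleB HN l (u (maxn k m)) (u k); lra.
Qed.

(** The Baire category theorem, in the form: countably many sets with dense
    interiors have a common point. *)
Lemma bigcap_interior_dense (P : nat -> set X) :
    (forall k x r, 0 < r -> exists2 y, N (y - x) < r &
       exists2 s, 0 < s & [set z | N (z - y) <= s] `<=` P k) ->
  exists x, forall k, P k x.
Proof.
move=> denseP.
have step (q : nat * (X * R)) : exists p : X * R, 0 < q.2.2 ->
    [/\ 0 < p.2, p.2 <= q.2.2 / 2, N (p.1 - q.2.1) + p.2 <= q.2.2 &
        [set z | N (z - p.1) <= p.2] `<=` P q.1].
  case: q => k [x r] /=; have [r0|] := ltP 0 r; last by exists (x, r).
  have [y ltyx [s s0 sP]] := denseP k x (r / 2) ltac:(lra).
  exists (y, Num.min s (r / 2)) => _ /=; split.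
  - by rewrite lt_min s0; lra.
  - by rewrite ge_min lexx orbT.
  - have : Num.min s (r / 2) <= r / 2 by rewrite ge_min lexx orbT.
    lra.
  - by move=> z /= lez; apply: sP; apply: le_trans lez _; rewrite ge_min lexx.
have [f fP] := choice step.
(* The ball [b k.+1] is contained in [P k], in [b k], and has at most half the
   radius of [b k]. *)
pose b := fix b k : X * R := if k is j.+1 then f (j, b j) else (0, 1).
have b0 k : 0 < (b k).2 by elim: k => [|k /(fP (k, b k))[]] //=; lra.
have bP k := fP (k, b k) (b0 k).
have bhalf k : (b k).2 <= 2^-1 ^+ k.
  elim: k => [|k IH]; first by rewrite expr0.
  by have [_ + _ _] := bP k; rewrite exprS /=; lra.
have [||l lb] := nested_balls_limit (u := fst \o b) b0.
- apply: (squeeze_cvgr (f := fun=> 0) (h := fun k => 2^-1 ^+ k)).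
  + by near=> k; rewrite (ltW (b0 k)) bhalf.
  + exact: cvg_cst.
  + by apply: cvg_expr; rewrite ger0_norm; lra.
- by move=> k; have [_ _ + _] := bP k.
exists l => k; have [_ _ _ ] := bP k.
by apply; exact: (lb k.+1).
Unshelve. all: end_near. Qed.

End Frechet.

Theorem theorem2p11 (R : realType) (K : numFieldType)
    (HK : real_or_complex R K)
    (X : topologicalLmodType K) (N : X -> R) (HX : frechet N)
    (Xinf : ~ finite_dimensional X)
    (V : nat -> set X)
    (Vlin : forall n, linear_subspace (V n))
    (Vnested : forall n, V n `<=` V n.+1)
    (Vclosure : forall n, closure (V n) `<=` V n.+1)
    (Vdense : closure (\bigcup_n V n) = [set: X])
    (e : nat -> R)
    (e_pos : forall n, 0 < e n)
    (e_decr : nonincreasing_seq e)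
    (e_lim : e @ \oo --> (0 : R))
    (d_pos : (0 < d_inf N V)%E) :
  exists x : X,
    ~ exists2 M : R, 0 < M & forall n, rho N V n x <= M * e n.
Proof.
have HN := frechet_F_norm HX.
have [c c0 cV] := d_inf_gt0_witness d_pos.
have [|x xP] := @bigcap_interior_dense _ _ _ _ HX
  (fun k => [set x | exists n, k%:R * e n < rho N V n x]).
  move=> k x r r0.
  have [y yx [n ltn]] := exists_near_rho_gt HK HX Vlin e_lim c0 cV x k%:R r0.
  exists y => //; exists ((rho N V n y - k%:R * e n) / 2); first by lra.
  move=> z /= lez; exists n.
  have := fdist_lipschitz HN (Vlin n) y z.
  rewrite (F_normB HN y z); move: ltn lez; rewrite /rho; lra.
exists x => -[M M0 leM].
have [n] := xP (Num.trunc M).+1.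
apply/negP; rewrite -leNgt; apply: le_trans (leM n) _.
by rewrite ler_wpM2r ?(ltW (e_pos n)) // ltW // truncnS_gt.
Qed.
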